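(* (i) For every integer $n\geq 2$, $\chi_d^t(P_n\circ K_1)=n+1$. (ii) For every integer $n\geq 3$, $\chi_d^t(C_n\circ K_1)=n+1$.
   Context: All graphs are finite and simple. For a graph $G$ with no isolated vertex, a total dominator coloring (TD-coloring) of $G$ is a proper coloring of the vertices of $G$ in which each vertex of $G$ is adjacent to every vertex of some (nonempty) color class. The total dominator chromatic number $\chi_d^t(G)$ is the minimum number of color classes in a TD-coloring of $G$. For graphs $G$ and $H$, the corona $G\circ H$ is the graph arising from the disjoint union of $G$ with $|V(G)|$ copies of $H$ by adding edges between the $i$th vertex of $G$ and all vertices of the $i$th copy of $H$. $P_n$ and $C_n$ denote the path and the cycle on $n$ vertices, and $K_1$ is the one-vertex graph. *)

(* Defs.v *)
From mathcomp Require Import all_boot.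

Set Implicit Arguments.
Unset Strict Implicit.
Unset Printing Implicit Defensive.

Record sgraph := SGraph {
  vertex :> finType;
  adj : rel vertex;
  adj_sym : symmetric adj;
  adj_irrefl : irreflexive adj }.

Definition no_isolated (G : sgraph) : bool :=
  [forall v : G, exists u : G, adj v u].

Section Coloring.
Variables (G : sgraph) (k : nat).
Implicit Type c : {ffun G -> 'I_k}.

Definition color_class c (i : 'I_k) : {set G} := [set v | c v == i].

Definition proper_coloring c : bool :=
  [forall u : G, forall v : G, adj u v ==> (c u != c v)].

(* Every color is used, so that c has exactly k color classes, all of them
   nonempty. *)
Definition all_colors_used c : bool :=
  [forall i : 'I_k, color_class c i != set0].

Definition TD_coloring c : bool :=
  [&& all_colors_used c, proper_coloring c &
      [forall v : G, exists i : 'I_k, forall u in color_class c i, adj v u]].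

End Coloring.

Definition has_TD_coloring (G : sgraph) (k : nat) : bool :=
  [exists c : {ffun G -> 'I_k}, TD_coloring c].

Lemma has_TD_coloring_card (G : sgraph) :
  no_isolated G -> has_TD_coloring G #|G|.
Proof.
move=> /forallP Gn; apply/existsP; exists [ffun v => enum_rank v].
apply/and3P; split.
- apply/forallP=> i; apply/set0Pn; exists (enum_val i).
  by rewrite inE ffunE enum_valK.
- apply/forallP=> u; apply/forallP=> v; apply/implyP=> uv.
  rewrite !ffunE (inj_eq enum_rank_inj).
  by apply/eqP=> uv_eq; rewrite uv_eq adj_irrefl in uv.
- apply/forallP=> v; have /existsP[u vu] := Gn v.
  apply/existsP; exists (enum_rank u); apply/forallP=> w; apply/implyP.
  by rewrite inE ffunE (inj_eq enum_rank_inj) => /eqP->.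
Qed.

Lemma ex_TD_coloring (G : sgraph) :
  no_isolated G -> exists k, has_TD_coloring G k.
Proof. by move=> Gn; exists #|G|; apply: has_TD_coloring_card. Qed.

(* Only defined for graphs without isolated vertices, which are exactly those
   that admit a TD-coloring. *)
Definition TD_chromatic (G : sgraph) (Gn : no_isolated G) : nat :=
  ex_minn (ex_TD_coloring Gn).

Section Corona.
Variables G H : sgraph.

(* inl x is the vertex x of G; inr (x, a) is the vertex a of the copy of H
   attached to x. *)
Definition corona_adj : rel (G + G * H) := fun p q =>
  match p, q with
  | inl x, inl y => adj x y
  | inl x, inr (y, _) => x == y
  | inr (x, _), inl y => x == y
  | inr (x, a), inr (y, b) => (x == y) && adj a b
  end.

Lemma corona_sym : symmetric corona_adj.
Proof.
by move=> [x|[x a]] [y|[y b]] /=; rewrite 1?eq_sym // adj_sym.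
Qed.

Lemma corona_irrefl : irreflexive corona_adj.
Proof. by move=> [x|[x a]] /=; rewrite adj_irrefl ?andbF. Qed.

Definition corona : sgraph := SGraph corona_sym corona_irrefl.

Lemma corona_no_isolated : 0 < #|H| -> no_isolated corona.
Proof.
move=> /card_gt0P[a _]; apply/forallP=> -[x|[x b]]; apply/existsP.
  by exists (inr (x, a)) => /=.
by exists (inl x) => /=.
Qed.

End Corona.

Section StandardGraphs.
Variable n : nat.

Definition path_adj : rel 'I_n :=
  fun i j => (j == i.+1 :> nat) || (i == j.+1 :> nat).

Lemma path_sym : symmetric path_adj.
Proof. by move=> i j; rewrite /path_adj orbC. Qed.

Lemma path_irrefl : irreflexive path_adj.
Proof. by move=> i; rewrite /path_adj orbb ltn_eqF. Qed.

Definition path_graph : sgraph := SGraph path_sym path_irrefl.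

(* ordS is the successor modulo n. The condition i != j only matters for
   n = 1; the cycle C_n is the intended object for n >= 3. *)
Definition cycle_adj : rel 'I_n :=
  fun i j => (i != j) && ((j == ordS i) || (i == ordS j)).

Lemma cycle_sym : symmetric cycle_adj.
Proof. by move=> i j; rewrite /cycle_adj eq_sym orbC. Qed.

Lemma cycle_irrefl : irreflexive cycle_adj.
Proof. by move=> i; rewrite /cycle_adj eqxx. Qed.

Definition cycle_graph : sgraph := SGraph cycle_sym cycle_irrefl.

Definition complete_adj : rel 'I_n := fun i j => i != j.

Lemma complete_sym : symmetric complete_adj.
Proof. by move=> i j; rewrite /complete_adj eq_sym. Qed.

Lemma complete_irrefl : irreflexive complete_adj.
Proof. by move=> i; rewrite /complete_adj eqxx. Qed.

Definition complete_graph : sgraph := SGraph complete_sym complete_irrefl.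

End StandardGraphs.

Definition K1 : sgraph := complete_graph 1.

Lemma corona_K1_no_isolated (G : sgraph) : no_isolated (corona G K1).
Proof. by apply: corona_no_isolated; rewrite card_ord. Qed.

(* Main.v *)
Require Import Defs.
From mathcomp Require Import all_boot.

(** For every nonempty graph [G] without isolated vertices, the corona of [G]
    with [K1] has total dominator chromatic number [#|G| + 1]; paths and cycles
    enter only through having no isolated vertex.

    The corona attaches one leaf to each vertex [x] of [G], and the only
    neighbour of that leaf is [x].  A nonempty color class dominated by the leaf
    must therefore be [{x}], so every vertex of [G] is alone in its class
    ([base_vertex_color_unique]).  These are [#|G|] classes, none of which
    contains a leaf, so the leaves need one more ([TD_coloring_corona_K1_lower]).
    Conversely, it suffices to give the vertices of [G] distinct colors and all
    the leaves one common new color: a leaf dominates the class of its support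
    vertex, and a vertex of [G] dominates the singleton class of any of its
    neighbours in [G] ([has_TD_coloring_corona_K1]). *)

(** The class dominated by the leaf at [x] lies in the neighbourhood [{x}] of
    that leaf; being nonempty, it is the class of [x]. *)
Lemma base_vertex_color_unique (G : sgraph) k
    (c : {ffun corona G K1 -> 'I_k}) (x : G) (p : corona G K1) :
  TD_coloring c -> c p = c (inl x) -> p = inl x.
Proof.
case/and3P=> /forallP used _ /forallP dom.
have /existsP[i /forallP leaf_dom] := dom (inr (x, ord0)).
have class_sub q : c q = i -> q = inl x.
  move=> cq; have := leaf_dom q; rewrite inE cq eqxx /=.
  by case: q {cq} => [y /eqP <- | [y b]] //=; rewrite /complete_adj !ord1 eqxx andbF.
have /set0Pn[q] := used i; rewrite inE => /eqP cq.
by move=> cpx; apply: (class_sub p); rewrite cpx -(class_sub q cq).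
Qed.

(** The bound is strict because a leaf cannot share the color of any vertex of
    [G]. *)
Lemma TD_coloring_corona_K1_lower (G : sgraph) k
    (c : {ffun corona G K1 -> 'I_k}) :
  0 < #|G| -> TD_coloring c -> #|G| < k.
Proof.
move=> /card_gt0P[x0 _] cTD; have uniq_c := base_vertex_color_unique _ _ c.
(* [None] stands for the color of one arbitrary leaf. *)
pose f (o : option G) : 'I_k :=
  if o is Some x then c (inl x) else c (inr (x0, ord0)).
rewrite -[k]card_ord -card_option; apply: (@leq_card _ _ f).
move=> [x|] [y|] //= cxy; first by case: (uniq_c y _ cTD cxy) => ->.
  by have := uniq_c x _ cTD (esym cxy).
by have := uniq_c y _ cTD cxy.
Qed.

(** Leaves are pairwise nonadjacent, so they may all share the extra color.  The
    absence of isolated vertices in [G] gives each vertex of [G] a singleton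
    class to dominate: the class of leaves would do only if [#|G| = 1]. *)
Lemma has_TD_coloring_corona_K1 (G : sgraph) :
  0 < #|G| -> no_isolated G -> has_TD_coloring (corona G K1) (#|G| + 1).
Proof.
move=> /card_gt0P[x0 _] /forallP Gn.
pose col (p : corona G K1) : 'I_(#|G| + 1) :=
  if p is inl x then lshift 1 (enum_rank x) else rshift #|G| ord0.
have col_inl p x : col p = col (inl x) -> p = inl x.
  case: p => [y | q] /eqP /=; last by rewrite eq_rlshift.
  by rewrite eq_lshift (inj_eq enum_rank_inj) => /eqP ->.
apply/existsP; exists [ffun p => col p]; apply/and3P; split.
- apply/forallP=> i; apply/set0Pn; case: (split_ordP i) => j ->.
    by exists (inl (enum_val j)); rewrite inE ffunE /= enum_valK.
  by exists (inr (x0, ord0)); rewrite inE ffunE /= [j]ord1.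
- apply/forallP=> p; apply/forallP=> q; apply/implyP=> pq; rewrite !ffunE.
  apply/eqP=> cpq; have pNq : p <> q by move=> Epq; rewrite Epq adj_irrefl in pq.
  case: q => [y | [y b]] in pq cpq pNq *; first exact: pNq (col_inl _ _ cpq).
  case: p => [x | [x a]] in pq cpq pNq *.
    exact: pNq (esym (col_inl _ _ (esym cpq))).
  by move: pq; rewrite /= /complete_adj !ord1 eqxx andbF.
- have dom (p : corona G K1) (x : G) : adj p (inl x) -> [exists i : 'I_(#|G| + 1),
      forall u in color_class [ffun q => col q] i, adj p u].
    move=> px; apply/existsP; exists (col (inl x)); apply/forallP=> u.
    by apply/implyP; rewrite inE ffunE => /eqP /col_inl ->.
  apply/forallP=> -[x | [x a]]; last by apply: (dom _ x) => /=.
  by have /existsP[y xy] := Gn x; apply: (dom _ y).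
Qed.

Lemma TD_chromatic_corona_K1 (G : sgraph) :
  0 < #|G| -> no_isolated G ->
  @TD_chromatic (corona G K1) (corona_K1_no_isolated G) = #|G| + 1.
Proof.
move=> G_gt0 Gn; rewrite /TD_chromatic; case: ex_minnP => k /existsP[c cTD] k_min.
apply/eqP; rewrite eqn_leq k_min ?has_TD_coloring_corona_K1 //= addn1.
exact: TD_coloring_corona_K1_lower cTD.
Qed.

Lemma path_graph_no_isolated n : 2 <= n -> no_isolated (path_graph n).
Proof.
move=> n_gt1; apply/forallP=> i; apply/existsP.
have [i1_lt | i1_ge] := ltnP i.+1 n.
  by exists (Ordinal i1_lt); rewrite /= /path_adj /= eqxx.
have i_gt0 : 0 < i by rewrite -ltnS; apply: leq_trans i1_ge.
exists (Ordinal (leq_ltn_trans (leq_pred i) (ltn_ord i))).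
by rewrite /= /path_adj /= prednK // eqxx orbT.
Qed.

Lemma cycle_graph_no_isolated n : 2 <= n -> no_isolated (cycle_graph n).
Proof.
move=> n_gt1; apply/forallP=> i; apply/existsP; exists (ordS i).
rewrite /= /cycle_adj eqxx andbT -val_eqE /=.
have [i1_lt | i1_ge] := ltnP i.+1 n.
  by rewrite modn_small // ltn_eqF.
have Ei : i.+1 = n by apply/eqP; rewrite eqn_leq ltn_ord.
by rewrite Ei modnn -lt0n -ltnS Ei.
Qed.

Theorem theorem2 :
  (forall n : nat, 2 <= n ->
     @TD_chromatic (corona (path_graph n) K1)
       (corona_K1_no_isolated (path_graph n)) = n + 1)
  /\
  (forall n : nat, 3 <= n ->
     @TD_chromatic (corona (cycle_graph n) K1)
       (corona_K1_no_isolated (cycle_graph n)) = n + 1).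
Proof.
split=> n n_ge.
  rewrite TD_chromatic_corona_K1 ?path_graph_no_isolated ?card_ord //.
  exact: ltnW.
rewrite TD_chromatic_corona_K1 ?cycle_graph_no_isolated ?card_ord //.
  exact: leq_trans n_ge.
exact: ltnW.
Qed.
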